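(* Let $\mathsf{L}$ be any of the logics $\mathbf{PT}_0$, $\mathbf{PD}$, $\mathbf{PD}^{\vee}$, $\mathbf{InqL}$, $\mathbf{PID}$. Then $\mathsf{L}$ is expressively complete: for every finite nonempty set $N=\{i_1,\dots,i_n\}\subseteq\mathbb{N}$, $$\nabla_N=\{\llbracket\phi\rrbracket_N : \phi \text{ is a formula in the language of } \mathsf{L} \text{ whose propositional variables are among } p_{i_1},\dots,p_{i_n}\}.$$ In particular $\mathbf{PT}_0\equiv\mathbf{PD}\equiv\mathbf{PD}^{\vee}\equiv\mathbf{InqL}\equiv\mathbf{PID}$, i.e. for any two of these logics $\mathsf{L}_1,\mathsf{L}_2$, every formula in the language of $\mathsf{L}_1$ is semantically equivalent to a formula in the language of $\mathsf{L}_2$ and vice versa.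
   Context: Propositional variables are $p_i$, $i\in\mathbb{N}$. A valuation is a function $s:\mathbb{N}\to\{0,1\}$; a team is a set of valuations. For $N\subseteq\mathbb{N}$ finite, a valuation on $N$ is a function $N\to\{0,1\}$, $2^N$ is the set of all of these, and a team on $N$ is a subset of $2^N$. Formulas of $\mathbf{PT}_0$ are given by $$\phi::=p_i\mid\neg p_i\mid\bot\mid\mathop{=}(p_{i_1},\dots,p_{i_k},p_j)\mid(\phi\wedge\phi)\mid(\phi\otimes\phi)\mid(\phi\vee\phi)\mid(\phi\to\phi),$$ where $k\ge 0$ (for $k=0$ the dependence atom is $\mathop{=}(p_j)$). Truth on a team $X$ is defined by: - $X\models p_i$ iff $s(i)=1$ for all $s\in X$; $X\models\neg p_i$ iff $s(i)=0$ for all $s\in X$; $X\models\bot$ iff $X=\emptyset$; - $X\models\mathop{=}(p_{i_1},\dots,p_{i_k},p_j)$ iff for all $s,s'\in X$, if $s(i_1)=s'(i_1),\dots,s(i_k)=s'(i_k)$ then $s(j)=s'(j)$; - $X\models\phi\wedge\psi$ iff $X\models\phi$ and $X\models\psi$; - $X\models\phi\otimes\psi$ iff there are $Y,Z\subseteq X$ with $X=Y\cup Z$, $Y\models\phi$ and $Z\models\psi$; - $X\models\phi\vee\psi$ iff $X\models\phi$ or $X\models\psi$; - $X\models\phi\to\psi$ iff for all $Y\subseteq X$, $Y\models\phi$ implies $Y\models\psi$. The same clauses define $X\models\phi$ for teams $X$ on $N$ when all variables of $\phi$ have indices in $N$. Formulas $\phi,\psi$ are semantically equivalent if they are true on the same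 teams. The sublanguages are: $\mathbf{PD}$: atoms $p_i,\neg p_i,\bot,\mathop{=}(p_{i_1},\dots,p_{i_k},p_j)$, connectives $\wedge,\otimes$. $\mathbf{PD}^{\vee}$: atoms $p_i,\neg p_i,\bot$, connectives $\wedge,\otimes,\vee$. $\mathbf{PID}$: atoms $p_i,\bot,\mathop{=}(p_{i_1},\dots,p_{i_k},p_j)$, connectives $\wedge,\vee,\to$. $\mathbf{InqL}$: atoms $p_i,\bot$, connectives $\wedge,\vee,\to$. $\llbracket\phi\rrbracket_N:=\{X\subseteq 2^N : X\models\phi\}$, and $\nabla_N$ is the family of all nonempty downward closed collections of teams on $N$: $$\nabla_N=\{\mathcal{K}\subseteq \mathcal{P}(2^N) : \mathcal{K}\ne\emptyset\text{ and }(Y\subseteq X\in\mathcal{K}\Rightarrow Y\in\mathcal{K})\}.$$ *)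

(* Defs.v *)
From HB Require Import structures.
From mathcomp Require Import all_boot finmap boolp classical_sets.

Set Implicit Arguments.
Unset Strict Implicit.
Unset Printing Implicit Defensive.

Local Open Scope classical_set_scope.

(* [Dep [:: i_1; ...; i_k] j] is the dependence atom =(p_i1, ..., p_ik, p_j);
   the list may be empty. *)
Inductive formula : Type :=
| Var of nat
| NegVar of nat
| Bot
| Dep of seq nat & nat
| And of formula & formula
| Tensor of formula & formula
| Or of formula & formula
| Imp of formula & formula.

Fixpoint vars (phi : formula) : seq nat :=
  match phi with
  | Var i | NegVar i => [:: i]
  | Bot => [::]
  | Dep s j => rcons s j
  | And a b | Tensor a b | Or a b | Imp a b => vars a ++ vars b
  end.

Inductive logic := PT0 | PD | PDv | InqL | PID.

Definition has_negvar (L : logic) : bool :=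
  match L with PT0 | PD | PDv => true | InqL | PID => false end.

Definition has_dep (L : logic) : bool :=
  match L with PT0 | PD | PID => true | PDv | InqL => false end.

Definition has_tensor (L : logic) : bool :=
  match L with PT0 | PD | PDv => true | InqL | PID => false end.

Definition has_or (L : logic) : bool :=
  match L with PT0 | PDv | InqL | PID => true | PD => false end.

Definition has_imp (L : logic) : bool :=
  match L with PT0 | InqL | PID => true | PD | PDv => false end.

Fixpoint in_language (L : logic) (phi : formula) : bool :=
  match phi with
  | Var _ | Bot => true
  | NegVar _ => has_negvar L
  | Dep _ _ => has_dep L
  | And a b => in_language L a && in_language L b
  | Tensor a b => [&& has_tensor L, in_language L a & in_language L b]
  | Or a b => [&& has_or L, in_language L a & in_language L b]
  | Imp a b => [&& has_imp L, in_language L a & in_language L b]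
  end.

(* The clauses are the same for teams of valuations on all of nat and for teams
   on a finite N, so they are stated for teams over any type [V] of valuations,
   where [ev s i] is the value that [s : V] gives to the variable p_i. *)
Fixpoint sat (V : Type) (ev : V -> nat -> bool) (X : set V) (phi : formula)
    : Prop :=
  match phi with
  | Var i => forall s, X s -> ev s i = true
  | NegVar i => forall s, X s -> ev s i = false
  | Bot => X = set0
  | Dep is_ j => forall s s', X s -> X s' ->
      (forall i, i \in is_ -> ev s i = ev s' i) -> ev s j = ev s' j
  | And a b => sat ev X a /\ sat ev X b
  | Tensor a b => exists Y Z : set V,
      [/\ X = Y `|` Z, sat ev Y a & sat ev Z b]
  | Or a b => sat ev X a \/ sat ev X b
  | Imp a b => forall Y : set V, Y `<=` X -> sat ev Y a -> sat ev Y b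
  end.

Definition valuation : Type := nat -> bool.

Definition team : Type := set valuation.

Definition satisfies (X : team) (phi : formula) : Prop :=
  sat (fun s : valuation => s) X phi.

Definition sem_equiv (phi psi : formula) : Prop :=
  forall X : team, satisfies X phi <-> satisfies X psi.

Definition valuation_on (N : {fset nat}) : Type := {ffun N -> bool}.

Definition team_on (N : {fset nat}) : Type := set (valuation_on N).

(* The value [false] outside [N] is a dummy: truth on teams on [N] is only
   meant for formulas whose variables all lie in [N]. *)
Definition eval_on (N : {fset nat}) (s : valuation_on N) (i : nat) : bool :=
  if insub i is Some j then s j else false.

Definition satisfies_on (N : {fset nat}) (X : team_on N) (phi : formula)
    : Prop :=
  sat (@eval_on N) X phi.

Definition denotation (N : {fset nat}) (phi : formula) : set (team_on N) :=
  [set X : team_on N | satisfies_on X phi].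

Arguments denotation : clear implicits.

Definition nabla (N : {fset nat}) : set (set (team_on N)) :=
  [set K : set (team_on N) | K !=set0 /\
     forall X Y : team_on N, Y `<=` X -> K X -> K Y].

Arguments nabla : clear implicits.

Definition formulas_over (L : logic) (N : {fset nat}) : set formula :=
  [set phi | in_language L phi /\ {subset vars phi <= N}].

Definition expressively_complete (L : logic) : Prop :=
  forall N : {fset nat}, N != fset0 ->
    nabla N = [set denotation N phi | phi in formulas_over L N].

Definition translatable (L1 L2 : logic) : Prop :=
  forall phi, in_language L1 phi ->
    exists psi, in_language L2 psi /\ sem_equiv phi psi.

Definition logic_equiv (L1 L2 : logic) : Prop :=
  translatable L1 L2 /\ translatable L2 L1.

(* Main.v *)
Require Import Defs.
From mathcomp Require Import all_boot finmap boolp classical_sets.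

(** Truth is local, downward closed and holds on the empty team, so every
    denotation lies in [nabla N].  Conversely, over the finite set [N] each
    valuation is pinned down by a conjunction of literals, so "[Y] is included
    in [A]" is definable, by a tensor of such conjunctions or by a conjunction
    of their negations.  With disjunction, a downward closed [K] is the union
    over [A] in [K] of these collections.  Without it (in PD), [K] is the
    intersection over [A] not in [K] of the collections "[Y] does not include
    [A]"; if [A] has [k.+1] elements, these [Y] are the unions of a team
    disjoint from [A] and a team with at most [k] elements, and "at most [k]
    elements" is the [k]-fold tensor of the conjunction of the constancy atoms
    [=(p_i)].  The logics are then intertranslatable by locality. *)

Set Implicit Arguments.
Unset Strict Implicit.
Unset Printing Implicit Defensive.

Local Open Scope classical_set_scope.

(** * Empty team, downward closure and locality *)

Lemma sat_set0 (V : Type) (ev : V -> nat -> bool) (phi : formula) :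
  sat ev set0 phi.
Proof.
elim: phi => //=.
- move=> a IHa b IHb; exists set0, set0; split=> //; by rewrite setU0.
- by move=> a IHa b IHb; left.
- by move=> a IHa b IHb Y; rewrite subset0 => ->.
Qed.

Lemma sat_sub (V : Type) (ev : V -> nat -> bool) (phi : formula) (X Y : set V) :
  Y `<=` X -> sat ev X phi -> sat ev Y phi.
Proof.
elim: phi X Y => /=.
- by move=> i X Y YX h s /YX /h.
- by move=> i X Y YX h s /YX /h.
- by move=> X Y YX X0; rewrite -subset0 -X0.
- by move=> is_ j X Y YX h s s' /YX Xs /YX Xs'; exact: h.
- by move=> a IHa b IHb X Y YX [/(IHa _ _ YX) ? /(IHb _ _ YX) ?].
- move=> a IHa b IHb X Y YX [A [B [XE Aa Bb]]].
  (* Cutting both halves down to [Y] turns a split of [X] into a split of [Y]. *)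
  exists (Y `&` A), (Y `&` B); split.
  + by rewrite -setIUr -XE; apply/esym/setIidPl.
  + exact: IHa Aa.
  + exact: IHb Bb.
- by move=> a IHa b IHb X Y YX [/(IHa _ _ YX)|/(IHb _ _ YX)]; [left|right].
- by move=> a IHa b IHb X Y YX h Z ZY; apply: h; exact: subset_trans YX.
Qed.

(** Serves to pull a subteam of an image back to a subteam of [X], for the tensor and implication
    cases of [sat_image]. *)
Lemma image_setI_preimage (V W : Type) (f : V -> W) (X : set V) (Y : set W) :
  Y `<=` f @` X -> f @` (X `&` f @^-1` Y) = Y.
Proof.
move=> YX; apply/seteqP; split=> [_ [v [_ ?] <-] //|w Yw].
by have [v Xv vw] := YX _ Yw; exists v => //; split=> //=; rewrite vw.
Qed.

Lemma forall_mem_cat (I : eqType) (V : Type) (r1 r2 : seq I)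
    (P : V -> I -> Prop) :
  (forall v i, i \in r1 ++ r2 -> P v i) ->
  (forall v i, i \in r1 -> P v i) /\ (forall v i, i \in r2 -> P v i).
Proof. by move=> h; split=> v i ir; apply: h; rewrite mem_cat ir ?orbT. Qed.

(** Locality, in a form that covers the restriction of valuations to [N]. No injectivity of [f] is
    assumed, because every clause sees a valuation only through its values at the listed
    variables. *)
Lemma sat_image (V W : Type) (ev : V -> nat -> bool) (ew : W -> nat -> bool)
    (f : V -> W) (phi : formula) :
  (forall v i, i \in vars phi -> ew (f v) i = ev v i) ->
  forall X : set V, sat ev X phi <-> sat ew (f @` X) phi.
Proof.
have lit b i X : (forall v j, j \in [:: i] -> ew (f v) j = ev v j) ->
    (forall s, X s -> ev s i = b) <-> (forall s, (f @` X) s -> ew s i = b).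
  move=> E; split=> [h _ [v Xv <-]|h v Xv]; first by rewrite E ?inE //; exact: h.
  by rewrite -E ?inE //; apply: h; exists v.
elim: phi => /=.
- by move=> i E X; exact: lit.
- by move=> i E X; exact: lit.
- move=> _ X; split=> [->|X0]; first exact: image_set0.
  by rewrite -subset0 => v Xv; suff : set0 (f v) by []; rewrite -X0; exists v.
- move=> is_ j E X.
  have Ej v : ew (f v) j = ev v j by rewrite E // mem_rcons mem_head.
  have Es v i : i \in is_ -> ew (f v) i = ev v i.
    by move=> ii; rewrite E // mem_rcons inE ii orbT.
  split=> h.
  + move=> _ _ [v Xv <-] [w Xw <-] eqvw; rewrite !Ej; apply: h => // i ii.
    by rewrite -!Es //; exact: eqvw.
  + move=> v w Xv Xw eqvw; rewrite -!Ej; apply: h; [by exists v|by exists w|].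
    by move=> i ii; rewrite !Es //; exact: eqvw.
- move=> a IHa b IHb /forall_mem_cat[/IHa {}IHa /IHb {}IHb] X.
  by rewrite IHa IHb.
- move=> a IHa b IHb /forall_mem_cat[/IHa {}IHa /IHb {}IHb] X.
  split=> [[Y [Z [-> /IHa Ya /IHb Zb]]]|[Y [Z [XE Ya Zb]]]].
    by exists (f @` Y), (f @` Z); rewrite image_setU.
  exists (X `&` f @^-1` Y), (X `&` f @^-1` Z); split.
  + rewrite -setIUr -preimage_setU -XE; apply/esym/setIidPl.
    exact: preimage_image.
  + by apply/IHa; rewrite image_setI_preimage // XE; exact: subsetUl.
  + by apply/IHb; rewrite image_setI_preimage // XE; exact: subsetUr.
- move=> a IHa b IHb /forall_mem_cat[/IHa {}IHa /IHb {}IHb] X.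
  by rewrite IHa IHb.
- move=> a IHa b IHb /forall_mem_cat[/IHa {}IHa /IHb {}IHb] X.
  split=> h Y YX.
  + by rewrite -(image_setI_preimage YX) -IHa -IHb; apply: h; exact: subIsetl.
  + by rewrite IHa IHb; apply: h; exact: image_subset.
Qed.

(** * Closure properties of definable collections *)

Definition definable (L : logic) (N : {fset nat}) : set (set (team_on N)) :=
  [set denotation N phi | phi in formulas_over L N].

Section Definable.
Variables (L : logic) (N : {fset nat}).
Local Notation finteam := {set {ffun N -> bool}}.
Implicit Types (K : set (team_on N)) (Y Z : team_on N) (A : finteam).

Local Notation definable := (definable L (N := N)).

Lemma definable_ext K1 K2 :
  definable K1 -> (forall Y, K1 Y <-> K2 Y) -> definable K2.
Proof. by move=> dK1 /predeqP <-. Qed.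

Lemma definableI K1 K2 : definable K1 -> definable K2 -> definable (K1 `&` K2).
Proof.
move=> [a [La Na] <-] [b [Lb Nb] <-]; exists (And a b) => //.
by split=> [|i]; rewrite /= ?La // mem_cat => /orP[/Na|/Nb].
Qed.

Lemma definableU K1 K2 :
  has_or L -> definable K1 -> definable K2 -> definable (K1 `|` K2).
Proof.
move=> Lor [a [La Na] <-] [b [Lb Nb] <-]; exists (Or a b) => //.
by split=> [|i]; rewrite /= ?Lor ?La // mem_cat => /orP[/Na|/Nb].
Qed.

Lemma definable_tensor K1 K2 : has_tensor L -> definable K1 -> definable K2 ->
  definable [set X : team_on N | exists Y Z, [/\ X = Y `|` Z, K1 Y & K2 Z]].
Proof.
move=> Lt [a [La Na] <-] [b [Lb Nb] <-]; exists (Tensor a b) => //.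
by split=> [|i]; rewrite /= ?Lt ?La // mem_cat => /orP[/Na|/Nb].
Qed.

Lemma definable_imp K1 K2 : has_imp L -> definable K1 -> definable K2 ->
  definable [set X : team_on N | forall Y, Y `<=` X -> K1 Y -> K2 Y].
Proof.
move=> Li [a [La Na] <-] [b [Lb Nb] <-]; exists (Imp a b) => //.
by split=> [|i]; rewrite /= ?Li ?La // mem_cat => /orP[/Na|/Nb].
Qed.

Lemma definable_set0 : definable [set set0].
Proof. by exists Bot. Qed.

Lemma eval_on_fsval (s : valuation_on N) (i : N) : eval_on s (val i) = s i.
Proof. by rewrite /eval_on valK. Qed.

(** Where negated variables are missing, implication is available, and [Imp (Var i) Bot] replaces
    the literal. *)
Lemma definable_lit (i : N) (b : bool) :
  definable [set Y : team_on N | forall s, Y s -> s i = b].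
Proof.
have dvar : definable [set Y : team_on N | forall s, Y s -> s i = true].
  exists (Var (val i)).
    by split=> // j; rewrite inE => /eqP ->; exact: valP.
  by apply/seteqP; split=> Y h s /h; rewrite eval_on_fsval.
case: b => //; have [Ln|Ln] := boolP (has_negvar L).
  exists (NegVar (val i)).
    by split=> // j; rewrite inE => /eqP ->; exact: valP.
  by apply/seteqP; split=> Y h s /h; rewrite eval_on_fsval.
have Li : has_imp L by case: (L) Ln.
have := definable_imp Li dvar definable_set0.
move/definable_ext; apply=> X; split=> h.
(* If [s i] were true, the subteam [[set s]] would satisfy the antecedent and so be empty. *)
- move=> s Xs; apply/negbTE/negP => si.
  suff : [set s] s by rewrite (h [set s]) // => _ ->.
  by [].
- move=> Y YX Yi; apply/seteqP; split=> // s Ys.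
  by have := Yi _ Ys; rewrite (h _ (YX _ Ys)).
Qed.

Hypothesis N0 : N != fset0.

(** Provides the empty conjunction. With the tensor it is built from the two opposite literals at a
    point of [N], which is where [N] has to be nonempty; otherwise it is [Imp Bot Bot]. *)
Lemma definable_setT : definable setT.
Proof.
have [j jN] := fset0Pn _ N0; pose i : N := [` jN]%fset.
have [Lt|Lt] := boolP (has_tensor L).
  have := definable_tensor Lt (definable_lit i true) (definable_lit i false).
  move/definable_ext; apply=> X; split=> // _.
  exists (X `&` [set s | s i = true]), (X `&` [set s | s i = false]).
  split=> [|s []//|s []//]; apply/seteqP; split=> [s Xs|s [[]|[]]//].
  by case: (boolP (s i)) => [|/negbTE] si; [left|right].
have Li : has_imp L by case: (L) Lt.
have := definable_imp Li definable_set0 definable_set0.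
by move/definable_ext; apply=> Y; split=> // _ Z.
Qed.

Lemma definable_bigI (I : eqType) (r : seq I) (F : I -> set (team_on N)) :
  (forall i, i \in r -> definable (F i)) ->
  definable [set Y : team_on N | forall i, i \in r -> F i Y].
Proof.
elim: r => [|i r IHr] dF.
  by apply: definable_ext definable_setT _ => Y; split.
have dr : definable [set Y : team_on N | forall j, j \in r -> F j Y].
  by apply: IHr => j jr; apply: dF; rewrite inE jr orbT.
have := definableI (dF i (mem_head _ _)) dr.
move/definable_ext; apply=> Y; split.
- by move=> [Yi Yr] j; rewrite inE => /predU1P[->//|]; exact: Yr.
- by move=> h; split=> [|j jr]; apply: h; rewrite inE ?eqxx ?jr ?orbT.
Qed.

(** The empty disjunction is [Bot], hence the extra case [Y = set0]; it is harmless because the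
    empty team belongs to every collection in [nabla N]. *)
Lemma definable_bigU (I : eqType) (r : seq I) (F : I -> set (team_on N)) :
  has_or L -> (forall i, i \in r -> definable (F i)) ->
  definable [set Y : team_on N | Y = set0 \/ exists2 i, i \in r & F i Y].
Proof.
move=> Lor; elim: r => [|i r IHr] dF.
  have := definable_set0; move/definable_ext; apply=> Y.
  by split=> [->|[//|[]]//]; left.
have dr : definable [set Y : team_on N | Y = set0 \/ exists2 i, i \in r & F i Y].
  by apply: IHr => j jr; apply: dF; rewrite inE jr orbT.
have := definableU Lor (dF i (mem_head _ _)) dr.
move/definable_ext; apply=> Y; split.
- move=> [Yi|[->|[j jr Yj]]]; [right; exists i|left|right; exists j] => //.
    by rewrite mem_head.
  by rewrite inE jr orbT.
- move=> [->|[j]]; first by right; left.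
  by rewrite inE => /predU1P[->|jr Yj]; [left|right; right; exists j].
Qed.

(** * Comparing a team with a fixed finite set of valuations *)

Lemma definable_sub1 (s : valuation_on N) :
  definable [set Y : team_on N | Y `<=` [set s]].
Proof.
have := @definable_bigI N (enum {: N})
  (fun i => [set Y : team_on N | forall t, Y t -> t i = s i]).
move=> /(_ (fun i _ => definable_lit i (s i))).
move/definable_ext; apply=> Y; split=> h.
- by move=> t Yt; apply/ffunP => i; apply: h => //; rewrite mem_enum.
- by move=> i _ t /h ->.
Qed.

Lemma definable_sub_seq (r : seq (valuation_on N)) :
  has_tensor L -> definable [set Y : team_on N | forall s, Y s -> s \in r].
Proof.
move=> Lt; elim: r => [|s r IHr].
  have := definable_set0; move/definable_ext; apply=> Y; split=> [->//|h].
  by apply/seteqP; split=> // s /h.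
have := definable_tensor Lt (definable_sub1 s) IHr.
move/definable_ext; apply=> X; split.
- move=> [Y [Z [-> Ys Zr]]] t [/Ys ->|/Zr tr]; rewrite inE ?eqxx //.
  by rewrite tr orbT.
- move=> h; exists (X `&` [set s]), (X `&` [set t | t \in r]).
  split=> [|t []//|t []//]; apply/seteqP; split=> [t Xt|t [[]|[]]//].
  by have := h _ Xt; rewrite inE => /predU1P[ts|tr]; [left|right].
Qed.

Lemma definable_sub A : definable [set Y : team_on N | forall s, Y s -> s \in A].
Proof.
have [Lt|Lt] := boolP (has_tensor L).
  have := definable_sub_seq (enum A) Lt.
  by move/definable_ext; apply=> Y; split=> h s /h; rewrite mem_enum.
have Li : has_imp L by case: (L) Lt.
(* For each [s] outside [A], the implication to [Bot] says that [Y] has no nonempty subteam inside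
   [[set s]], that is, [s] is not in [Y]. *)
have := definable_bigI (r := enum (~: A)%SET)
  (fun s _ => definable_imp Li (definable_sub1 s) definable_set0).
move/definable_ext; apply=> Y; split=> h.
- move=> s Ys; apply/negPn/negP => sA.
  have : [set s] s by [].
  rewrite (h s _ [set s]) ?mem_enum ?inE //.
  by move=> _ ->.
- move=> s; rewrite mem_enum inE => sA Z ZY Zs; apply/seteqP; split=> // t Zt.
  by move: sA; rewrite -(Zs _ Zt) h //; exact: ZY.
Qed.

(** Constancy of all variables in [N] allows at most one valuation, and each tensor factor adds one
    more. Bounding the size by a covering list makes the induction step the removal of its head. *)
Lemma definable_size_le (k : nat) : has_tensor L -> has_dep L ->
  definable [set Y : team_on N | exists2 r : seq (valuation_on N),
                       size r <= k & forall s, Y s -> s \in r].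
Proof.
move=> Lt Ld; elim: k => [|k IHk].
  have := definable_set0; move/definable_ext; apply=> Y; split.
    by move=> ->; exists [::].
  by move=> [[|//] _ h]; apply/seteqP; split=> // s /h.
have dc (i : N) :
    definable [set Y : team_on N | forall s t, Y s -> Y t -> s i = t i].
  exists (Dep [::] (val i)).
    by split=> // j; rewrite inE => /eqP ->; exact: valP.
  apply/seteqP; split=> Y h s t Ys Yt.
    by rewrite -!eval_on_fsval; exact: h.
  by rewrite !eval_on_fsval => _; exact: h.
have d1 := definable_bigI (r := enum {: N}) (fun i _ => dc i).
have := definable_tensor Lt d1 IHk.
move/definable_ext; apply=> X; split.
- move=> [Y [Z [-> Y1 [r rk Zr]]]].
  have [->|/set0P[s Ys]] := eqVneq Y set0.
    by exists r; [exact: leqW|move=> s [//|/Zr]].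
  exists (s :: r) => // t [Yt|/Zr tr]; rewrite inE ?tr ?orbT //.
  by apply/orP; left; apply/eqP/ffunP => i; apply: Y1; rewrite ?mem_enum.
- move=> [[|s r] rk h].
    have -> : X = set0 by rewrite -subset0 => t /h.
    exists set0, set0; split; [by rewrite setU0|by move=> i _ t u|by exists [::]].
  exists (X `&` [set s]), (X `&` [set t | t \in r]); split.
  + apply/seteqP; split=> [t Xt|t [[]|[]]//].
    by have := h _ Xt; rewrite inE => /predU1P[ts|tr]; [left|right].
  + by move=> i _ t u [_ ->] [_ ->].
  + by exists r => // t [].
Qed.

Lemma definable_not_sup A : has_tensor L -> has_dep L -> A != finset.set0 ->
  definable [set Y : team_on N | exists2 s, s \in A & ~ Y s].
Proof.
move=> Lt Ld A0.
have := definable_tensor Lt (definable_sub (~: A)%SET)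
  (definable_size_le #|A|.-1 Lt Ld).
move/definable_ext; apply=> X; split.
- move=> [Y [Z [-> YA [r rA Zr]]]].
  (* Otherwise all of [A] would lie in [Z], hence in the list [r], which is shorter than [A]. *)
  apply: contrapT => nA.
  have Ar : {subset A <= r}.
    move=> s sA; have [/YA|/Zr//] : (Y `|` Z) s.
      by apply: contrapT => nYZ; apply: nA; exists s.
    by rewrite inE sA.
  have : #|A| <= size r.
    rewrite cardE; apply: uniq_leq_size; first exact: enum_uniq.
    by move=> s; rewrite mem_enum => /Ar.
  by move=> /leq_trans /(_ rA); rewrite leqNgt prednK ?leqnn // card_gt0.
- move=> [s sA nXs].
  exists (X `&` [set t | t \notin A]), (X `&` [set t | t \in A]); split.
  + apply/seteqP; split=> [t Xt|t [[]|[]]//].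
    by have [tA|tA] := boolP (t \in A); [right|left].
  + by move=> t [_ /= tA]; rewrite inE.
  (* The part of [X] inside [A] misses [s], so the other [#|A|.-1] elements of [A] cover it. *)
  + exists (enum (A :\ s)%SET); first by rewrite -cardE (cardsD1 s A) sA.
    move=> t [Xt /= tA]; rewrite mem_enum !inE tA andbT.
    by apply: contra_notN nXs => /eqP <-.
Qed.

Lemma nabla_definable K : nabla N K -> definable K.
Proof.
move=> [[X0 KX0] Kdown].
(* Turning teams into finite sets makes the members of [K], and the non-members, enumerable. *)
pose fin Y : finteam := finset (fun s => `[< Y s >]).
have finE Y : [set` fin Y] = Y.
  by apply/seteqP; split=> s /=; rewrite inE => /asboolP.
have [Lor|Lor] := boolP (has_or L).
  have := definable_bigU
    (r := [seq A : finteam <- enum {: finteam} | `[< K [set` A] >]])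
    Lor (fun A _ => definable_sub A).
  move/definable_ext; apply=> Y; split.
  + move=> [->|[A]]; first exact: Kdown KX0.
    by rewrite mem_filter => /andP[/asboolP KA _] YA; exact: Kdown KA.
  + move=> KY; right; exists (fin Y); last by move=> s; rewrite -{1}(finE Y).
    by rewrite mem_filter mem_enum andbT; apply/asboolP; rewrite finE.
(* Only [PD] lacks disjunction. *)
have [Lt Ld] : has_tensor L /\ has_dep L by case: (L) Lor.
have dA A :
    A \in [seq A : finteam <- enum {: finteam} | `[< ~ K [set` A] >]] ->
    definable [set Y : team_on N | exists2 s, s \in A & ~ Y s].
  rewrite mem_filter => /andP[/asboolP nKA _]; apply: definable_not_sup => //.
  (* The empty team is in [K] by downward closure, so every [A] outside [K] is nonempty. *)
  apply/eqP => A0; apply: nKA; apply: Kdown KX0 => s /=.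
  by rewrite A0 inE.
have := definable_bigI dA.
move/definable_ext; apply=> Y; split.
- move=> h; apply: contrapT => nKY.
  (* A team outside [K] is itself among the sets intersected over, and it includes itself. *)
  have [|s] := h (fin Y).
    by rewrite mem_filter mem_enum andbT; apply/asboolP; rewrite finE.
  by rewrite inE => /asboolP.
- move=> KY A; rewrite mem_filter => /andP[/asboolP nKA _].
  apply: contrapT => nA; apply: nKA; apply: Kdown KY => s /= sA.
  by apply: contrapT => nYs; apply: nA; exists s.
Qed.

End Definable.

(** * Completeness and mutual translations *)

Lemma nabla_denotation (N : {fset nat}) (phi : formula) :
  nabla N (denotation N phi).
Proof.
split; first by exists set0; exact: sat_set0.
by move=> X Y; exact: sat_sub.
Qed.

Lemma expressively_completeP (L : logic) : expressively_complete L.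
Proof.
move=> N N0; apply/seteqP; split=> K; first exact: nabla_definable.
by move=> [phi _ <-]; exact: nabla_denotation.
Qed.

Definition restrict (N : {fset nat}) (s : valuation) : valuation_on N :=
  [ffun i => s (val i)].

Lemma satisfies_restrict (N : {fset nat}) (phi : formula) (X : team) :
  {subset vars phi <= N} ->
  satisfies X phi <-> denotation N phi (restrict N @` X).
Proof.
move=> sub; apply: sat_image => s i /sub iN.
by rewrite /eval_on insubT ffunE.
Qed.

Lemma complete_translatable (L1 L2 : logic) :
  expressively_complete L2 -> translatable L1 L2.
Proof.
move=> complete phi _.
(* [0] is added because completeness is about nonempty [N] only. *)
pose N : {fset nat} := [fset i in 0 :: vars phi]%fset.
have N0 : N != fset0 by apply/fset0Pn; exists 0; rewrite !inE.
have sub : {subset vars phi <= N} by move=> i iphi; rewrite !inE iphi orbT.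
(* Completeness of [L2] yields [psi] with the same denotation on [N]; restriction to [N] carries the
   equality back to teams of full valuations. *)
have := nabla_denotation N phi; rewrite (complete N N0) => -[psi [Lpsi Npsi] eq].
exists psi; split=> // X.
by rewrite (satisfies_restrict _ sub) (satisfies_restrict _ Npsi) eq.
Qed.

Theorem theorem1p7 :
  (forall L : logic, expressively_complete L) /\
  (forall L1 L2 : logic, logic_equiv L1 L2).
Proof.
split=> [|L1 L2]; first exact: expressively_completeP.
by split; apply: complete_translatable; exact: expressively_completeP.
Qed.
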